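(* Let $K$ be a field and let $I$ be a monomial ideal of $S=K[x_1,\dots,x_n]$. If $I$ is a tame ideal, then $I$ is a Lyubeznik ideal.
   Context: Let $G(I)=\{u_1,\dots,u_s\}$ be the minimal set of monomial generators of $I$ and write $u_i=x_1^{b_{i1}}x_2^{b_{i2}}\cdots x_n^{b_{in}}$ for $i=1,\dots,s$. $I$ is generic if for all $i\neq j$ and all $k\in\{1,\dots,n\}$, $b_{ik}\neq b_{jk}$ unless $b_{ik}=b_{jk}=0$. A generic monomial ideal $I$ is a mean ideal if for each pair of elements $u_i$ and $u_j$ the following holds: whenever there exists $k\in\{1,\dots,n\}$ with $0<b_{ik}<b_{jk}$, then for every $k\in\{1,\dots,n\}$ either $b_{ik}<b_{jk}$ or $b_{jk}=0$. In a mean ideal, write $u_i\prec u_j$ if there exists $k\in\{1,\dots,n\}$ with $0<b_{ik}<b_{jk}$. A mean ideal $I$ is a tame ideal if $(G(I),\prec)$ is a partially ordered set (with $\prec$ as the strict order relation). For $A\subseteq G(I)$, the multidegree $m(A)$ is the least common multiple of the elements of $A$. Let $<$ be a total order on $G(I)$, and let $\min$ denote least element under $<$. The Lyubeznik simplicial complex $L_{(I,<)}$ is the simplicial complex on $G(I)$ whose faces are the $F\subseteq G(I)$ such that for every nonempty $G\subseteq F$, $\min\{u\in G(I): u\mid m(G)\}\in G$. The Lyubeznik resolution of $I$ under $<$ is the free resolution $\cdots\to L_2\xrightarrow{\varphi_1}L_1\xrightarrow{\varphi_0}I\to0$, where $L_i$ is the free $S$-module with basis the faces $F\in L_{(I,<)}$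 with $|F|=i$, $\varphi_0(\{u\})=u$, and for a face $F=\{u_{j_1}<\cdots<u_{j_i}\}$ with $i\ge2$, $\varphi_{i-1}(F)=\sum_{k=1}^{i}(-1)^{k+1}\frac{m(F)}{m(G_k)}G_k$ with $G_k=F\setminus\{u_{j_k}\}$. It is known that this is a free resolution of $I$. It is minimal if $\varphi_{i-1}(L_i)\subseteq(x_1,\dots,x_n)L_{i-1}$ for all $i\ge2$. $I$ is a Lyubeznik ideal if there is a total order on $G(I)$ such that the corresponding Lyubeznik resolution of $I$ is minimal. *)

(* Defs.v *)
From HB Require Import structures.
From mathcomp Require Import all_boot all_order all_algebra.
From mathcomp Require Import finmap.
From mathcomp Require Import mpoly.
Set Implicit Arguments.
Unset Strict Implicit.
Unset Printing Implicit Defensive.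
Import GRing.Theory.
Local Open Scope ring_scope.

(* A monomial of S = {mpoly K[n]} is represented by its exponent vector        *)
(* u : 'X_{1..n}; u divides v iff (u <= v)%MM, and the lcm is mlcm.            *)

Section MonomialIdeals.
Variables (K : fieldType) (n : nat).
Implicit Types (I : {mpoly K[n]} -> Prop) (G : {fset 'X_{1..n}}).

Definition monomial_span (M : 'X_{1..n} -> Prop) (p : {mpoly K[n]}) : Prop :=
  exists2 r : seq ({mpoly K[n]} * 'X_{1..n}),
    (forall c, c \in r -> M c.2) & p = \sum_(c <- r) c.1 * 'X_[c.2].

Definition monomially_generated I (M : 'X_{1..n} -> Prop) : Prop :=
  forall p, I p <-> monomial_span M p.

Definition monomial_ideal I : Prop :=
  exists M : 'X_{1..n} -> Prop, monomially_generated I M.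

(* "G is G(I)"; see [minimal_generators_unique] below. *)
Definition minimal_generators I G : Prop :=
  monomially_generated I (fun u => u \in G) /\
  forall H : {fset 'X_{1..n}}, (H `<` G)%fset ->
    ~ monomially_generated I (fun u => u \in H).

End MonomialIdeals.

Section Tame.
Variable n : nat.
Implicit Type G : {fset 'X_{1..n}}.

Definition generic G : Prop :=
  forall u v, u \in G -> v \in G -> u != v ->
  forall k : 'I_n, u k = v k -> u k = 0%N.

Definition prec (u v : 'X_{1..n}) : bool :=
  [exists k : 'I_n, (0 < u k < v k)%N].

Definition mean G : Prop :=
  generic G /\
  forall u v, u \in G -> v \in G -> prec u v ->
  forall k : 'I_n, (u k < v k)%N \/ v k = 0%N.

Definition tame G : Prop :=
  [/\ mean G, {in G, irreflexive prec} & {in G & &, transitive prec}].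

End Tame.

Definition total_order (T : Type) (le : rel T) : Prop :=
  [/\ reflexive le, antisymmetric le, transitive le & total le].

Section Lyubeznik.
Variables (K : fieldType) (n : nat) (G : {fset 'X_{1..n}}) (le : rel G).

Definition mdegree (A : {set G}) : 'X_{1..n} :=
  \big[@mlcm n/0%MM]_(u in A) val u.

Definition is_min (B : {set G}) (u : G) : bool :=
  (u \in B) && [forall v in B, le u v].

Definition lyubeznik_face (F : {set G}) : bool :=
  [forall A : {set G}, (A \subset F) && (A != set0) ==>
    [exists u in A, is_min [set v : G | (val v <= mdegree A)%MM] u]].

Definition face (i : nat) : finType :=
  {F : {set G} | lyubeznik_face F && (#|F| == i)}.

(* The free S-module L_i; the regular module S^o makes it an S-module. *)
Definition lyubeznik_module (i : nat) : lmodType {mpoly K[n]} :=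
  {ffun face i -> {mpoly K[n]}^o}.

(* The basis vector of a face H; the value at an H that is not a face of       *)
(* cardinality i is the junk value 0. Below, H is always such a face, since    *)
(* lyubeznik_face is closed under taking subsets.                              *)
Definition basis_vector (i : nat) (H : {set G}) : lyubeznik_module i :=
  [ffun F : face i => (val F == H)%:R].

(* 0-based position of u in F listed increasingly, so the sign (-1)^(k+1) of   *)
(* the k-th element (k >= 1) is (-1) ^+ position.                              *)
Definition position (F : {set G}) (u : G) : nat :=
  #|[set v in F | le v u && (v != u)]|.

Definition face_boundary (i : nat) (F : face i.+1) : lyubeznik_module i :=
  \sum_(u in val F)
    ((-1) ^+ position (val F) u *
     'X_[(mdegree (val F) - mdegree (val F :\ u))%MM])
    *: basis_vector i (val F :\ u).

(* The differential phi_i : L_(i+1) -> L_i for i >= 1. *)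
Definition boundary (i : nat) (x : lyubeznik_module i.+1) :
    lyubeznik_module i :=
  \sum_(F : face i.+1) (x F : {mpoly K[n]}) *: face_boundary F.

Definition in_max_ideal (p : {mpoly K[n]}) : Prop :=
  exists c : 'I_n -> {mpoly K[n]}, p = \sum_(k < n) c k * 'X_k.

Definition in_max_ideal_mul (V : lmodType {mpoly K[n]}) (y : V) : Prop :=
  exists2 r : seq ({mpoly K[n]} * V),
    (forall c, c \in r -> in_max_ideal c.1) & y = \sum_(c <- r) c.1 *: c.2.

Definition minimal_lyubeznik_resolution : Prop :=
  forall i, (0 < i)%N ->
  forall x : lyubeznik_module i.+1, in_max_ideal_mul (boundary x).

End Lyubeznik.

Section Ideals.
Variables (K : fieldType) (n : nat).
Implicit Types (I : {mpoly K[n]} -> Prop) (G : {fset 'X_{1..n}}).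

Definition tame_ideal I : Prop :=
  exists2 G, minimal_generators I G & tame G.

Definition lyubeznik_ideal I : Prop :=
  exists2 G, minimal_generators I G &
  exists2 le : rel G, total_order le & minimal_lyubeznik_resolution K le.

Lemma monomial_span_dvd (M : 'X_{1..n} -> Prop) m :
  monomial_span M ('X_[m] : {mpoly K[n]}) -> exists2 u, M u & (u <= m)%MM.
Proof.
case=> r Mr /(congr1 (mcoeff m)); rewrite mcoeffX eqxx raddf_sum /= => E.
have [/hasP[c cr cm]|/hasPn nr] := boolP (has (fun c => (c.2 <= m)%MM) r).
  by exists c.2 => //; apply: Mr.
move/eqP: E; rewrite big_seq big1 ?oner_eq0 // => c cr.
apply: memN_msupp_eq0; apply/negP => /=.
rewrite (perm_mem (msuppMX _ _)) => /mapP[m' _ mE].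
by move: (nr c cr); rewrite mE lem_addr // lepm_refl.
Qed.

Lemma monomial_spanM (M N : 'X_{1..n} -> Prop) (p : {mpoly K[n]}) :
  (forall u, M u -> exists2 v, N v & (v <= u)%MM) ->
  monomial_span M p -> monomial_span N p.
Proof.
move=> MN [r + ->]; elim: r => [|c r IH] Mr.
  by exists [::] => //; rewrite !big_nil.
have [s sN sE] := IH (fun d dr => Mr d (mem_behead (s := c :: r) dr)).
have [v Nv vc] := MN _ (Mr c (mem_head c r)).
exists ((c.1 * 'X_[c.2 - v], v) :: s).
  by move=> d; rewrite inE => /orP[/eqP->|/sN].
by rewrite !big_cons sE /= -mulrA -mpolyXD submK.
Qed.

Lemma monomial_span_gen (M : 'X_{1..n} -> Prop) m :
  M m -> monomial_span M ('X_[m] : {mpoly K[n]}).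
Proof.
move=> Mm; exists [:: (1, m)]; last by rewrite big_seq1 mul1r.
by move=> c; rewrite inE => /eqP->.
Qed.

Lemma minimal_generators_antichain I G u v :
  minimal_generators I G -> u \in G -> v \in G -> (u <= v)%MM -> u = v.
Proof.
move=> [IG minG] uG vG uv; apply/eqP/negPn/negP => nuv.
apply: (minG (G `\ v)%fset); first by rewrite fproperD1.
move=> p; split=> [/IG|Hp].
  apply: monomial_spanM => w wG.
  have [->|nwv] := eqVneq w v; first by exists u; rewrite // !inE nuv.
  by exists w; rewrite ?lepm_refl // !inE nwv.
apply/IG; apply: monomial_spanM Hp => w; rewrite !inE => /andP[_ wG].
by exists w; rewrite ?lepm_refl.
Qed.

Lemma minimal_generators_unique I G H :
  minimal_generators I G -> minimal_generators I H -> G = H.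
Proof.
have sub G' H' : minimal_generators I G' -> minimal_generators I H' ->
    forall u, u \in G' -> u \in H'.
  move=> mG mH u uG; case: (mG) (mH) => [IG _] [IH _].
  have /monomial_span_dvd[v vH vu] : monomial_span (fun u => u \in H')
      ('X_[u] : {mpoly K[n]}) by apply/IH/IG/monomial_span_gen.
  have /monomial_span_dvd[w wG wv] : monomial_span (fun u => u \in G')
      ('X_[v] : {mpoly K[n]}) by apply/IG/IH/monomial_span_gen.
  have wu := minimal_generators_antichain mG wG uG (lepm_trans wv vu).
  suff -> : u = v by [].
  move: vu wv; rewrite wu => /mnm_lepP vu /mnm_lepP uv.
  by apply/mnmP => i; apply/eqP; rewrite eqn_leq vu uv.
by move=> mG mH; apply/fsetP => u; apply/idP/idP; apply: sub.
Qed.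

End Ideals.

(* Main.v *)
Require Import Defs.
From HB Require Import structures.
From mathcomp Require Import all_boot all_order all_algebra.
From mathcomp Require Import finmap.
From mathcomp Require Import mpoly.

(* Order G(I) by a linear extension of [prec].  If F is a face with at least  *)
(* two elements and u in F divides m(F \ u), then by genericity every variable *)
(* of u occurs with a strictly larger exponent in some v in F \ u, so that    *)
(* u precedes v.  These v form a nonempty A with u | m(A), and u is smaller   *)
(* than every element of A: the least generator dividing m(A) is not in A,    *)
(* contradicting that F is a face.  Hence m(F) / m(F \ u) is never 1.         *)

Set Implicit Arguments.
Unset Strict Implicit.
Unset Printing Implicit Defensive.
Import GRing.Theory.
Local Open Scope ring_scope.

(** Up to sign, the coefficients of the differential are the monomials m(F)/m(F \ u), so minimality
    reduces to none of them being 1 when F has at least two elements. This is [face_ndvd_mdegree],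
    and [generic_minimal_lyubeznik] passes to the resolution, for any [le] compatible with [prec].
    Tameness makes [prec] a strict partial order on G(I), and [linear_extension] then provides such
    an [le]. *)

Section MaxIdeal.
Variables (K : fieldType) (n : nat).
Implicit Types (p q : {mpoly K[n]}) (V : lmodType {mpoly K[n]}).

Lemma in_max_idealM p q : in_max_ideal q -> in_max_ideal (p * q).
Proof.
case=> c ->; exists (fun k => p * c k).
by rewrite mulr_sumr; apply: eq_bigr => k _; rewrite mulrA.
Qed.

Lemma in_max_idealX (m : 'X_{1..n}) :
  m != 0%MM -> in_max_ideal ('X_[m] : {mpoly K[n]}).
Proof.
move=> m0; have [k mk|m_eq0] := pickP (fun k : 'I_n => 0 < m k)%N; last first.
  case/eqP: m0; apply/mnmP => k; rewrite mnm0E.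
  by apply/eqP; rewrite -leqn0 leqNgt m_eq0.
exists (fun j => if j == k then 'X_[m - U_(k)] else 0).
rewrite (bigD1 k) //= eqxx big1 => [|j /negPf->]; last by rewrite mul0r.
rewrite addr0 -mpolyXD submK //; apply/mnm_lepP => j.
by rewrite mnm1E; case: eqP => [<-|].
Qed.

Lemma in_max_ideal_mulD V (x y : V) :
  in_max_ideal_mul x -> in_max_ideal_mul y -> in_max_ideal_mul (x + y).
Proof.
case=> r rP -> [s sP ->]; exists (r ++ s); last by rewrite big_cat.
by move=> c; rewrite mem_cat => /orP[/rP|/sP].
Qed.

Lemma in_max_ideal_mul_sum V (J : finType) (P : pred J) (f : J -> V) :
  (forall j, P j -> in_max_ideal_mul (f j)) ->
  in_max_ideal_mul (\sum_(j | P j) f j).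
Proof.
apply: big_ind; last exact: in_max_ideal_mulD.
by exists [::]; rewrite ?big_nil.
Qed.

Lemma in_max_ideal_scale V p (x : V) :
  in_max_ideal p -> in_max_ideal_mul (p *: x).
Proof.
by exists [:: (p, x)]; rewrite ?big_seq1 // => c; rewrite inE => /eqP->.
Qed.

Lemma in_max_ideal_mulZ V p (x : V) :
  in_max_ideal_mul x -> in_max_ideal_mul (p *: x).
Proof.
case=> r rP ->; rewrite scaler_sumr big_seq.
elim/big_ind: _; first by exists [::]; rewrite ?big_nil.
  exact: in_max_ideal_mulD.
move=> c cr; rewrite scalerA.
exact/in_max_ideal_scale/in_max_idealM/rP.
Qed.

End MaxIdeal.

Section LinearExtension.
Variables (T : finType) (r : rel T).

Definition down_card (x : T) : nat := #|[set y | r y x]|.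

(** Along a strict order the number of predecessors strictly increases; [enum_rank] only breaks
    ties, to make the order total. *)
Definition linear_extension (x y : T) : bool :=
  (down_card x < down_card y)%N ||
  (down_card x == down_card y) && (enum_rank x <= enum_rank y)%N.

Lemma linear_extension_total_order : total_order linear_extension.
Proof.
rewrite /linear_extension; split.
- by move=> x; rewrite eqxx leqnn orbT.
- move=> x y; case: ltngtP => //= _ /anti_leq/val_inj; exact: enum_rank_inj.
- move=> y x z.
  case: (ltngtP (down_card x) (down_card y)) => //= [xy _|-> xy].
    by case/orP=> [/(ltn_trans xy)->|/andP[/eqP<- _]]; rewrite ?xy.
  by case: ltngtP => //= _; apply: leq_trans.
- by move=> x y; case: ltngtP => //= _; apply: leq_total.
Qed.

Hypotheses (r_irr : irreflexive r) (r_trans : transitive r).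

(** By transitivity the predecessors of [x] are predecessors of [y]; by irreflexivity the inclusion
    is strict, with [x] itself as the extra element. *)
Lemma linear_extensionF (x y : T) : r x y -> linear_extension y x = false.
Proof.
move=> rxy; have lt_xy : (down_card x < down_card y)%N.
  apply/proper_card/properP; split.
    by apply/subsetP => z; rewrite !inE => /r_trans; apply.
  by exists x; rewrite inE ?r_irr.
by rewrite /linear_extension ltnNge ltnW //= gtn_eqF.
Qed.

End LinearExtension.

Section LyubeznikFaces.
Variables (n : nat) (G : {fset 'X_{1..n}}).
Implicit Types (u v : G) (A F : {set G}).

Lemma mdegreeE A (k : 'I_n) : mdegree A k = \max_(v in A) val v k.
Proof.
rewrite /mdegree; elim/big_rec2: _ => [|v a m _ <-]; first by rewrite mnm0E.
by rewrite mnmE.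
Qed.

Lemma leq_mdegree A v (k : 'I_n) : v \in A -> (val v k <= mdegree A k)%N.
Proof. by move=> vA; rewrite mdegreeE; apply: (bigmax_sup v). Qed.

(** Positivity excludes the empty [A], whose maximum is the default value 0. *)
Lemma mdegree_attained A (k : 'I_n) :
  (0 < mdegree A k)%N -> exists2 v, v \in A & mdegree A k = val v k.
Proof.
rewrite mdegreeE => max_gt0.
have [A0|[x xA]] := set_0Vmem A; first by rewrite A0 big_set0 in max_gt0.
have [|v vA ->] := @eq_bigmax_cond _ (mem A) (fun v : G => val v k).
  by apply/card_gt0P; exists x.
by exists v.
Qed.

Variable le : rel G.
Hypothesis prec_le : forall u v, prec (val u) (val v) -> ~~ le v u.
Hypothesis G_generic : generic G.
Hypothesis G_antichain : forall u v, (val u <= val v)%MM -> u = v.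

Lemma face_ndvd_mdegree F u :
  lyubeznik_face le F -> (1 < #|F|)%N -> u \in F ->
  ~~ (val u <= mdegree (F :\ u))%MM.
Proof.
move=> faceF cardF uF; apply/negP => /mnm_lepP u_dvd.
pose A := [set v in F :\ u | prec (val u) (val v)].
have A_var (k : 'I_n) : (0 < val u k)%N ->
    exists2 v, v \in A & (val u k < val v k)%N.
  move=> uk; have [|v vFu Ev] := @mdegree_attained (F :\ u) k.
    exact: leq_trans (u_dvd k).
  have uv : (val u k < val v k)%N.
    (* Equal exponents in [u] and [v] would both be 0 by genericity, but that of [u] is positive. *)
    rewrite ltn_neqAle -Ev u_dvd andbT Ev; apply/eqP => E.
    move: vFu; rewrite !inE => /andP[vu _].
    have nuv : val u != val v by rewrite eq_sym (inj_eq val_inj).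
    by rewrite (G_generic (fsvalP u) (fsvalP v) nuv E) in uk.
  by exists v => //; rewrite inE vFu; apply/existsP; exists k; rewrite uk.
have u_dvdA : (val u <= mdegree A)%MM.
  apply/mnm_lepP => k; have [->//|/A_var[v vA uv]] := posnP (val u k).
  exact: leq_trans (ltnW uv) (leq_mdegree k vA).
have A_neq0 : A != set0.
  have [k uk|u_eq0] := pickP (fun k : 'I_n => 0 < val u k)%N.
    by have [v vA _] := A_var k uk; apply/set0Pn; exists v.
  (* Here [u] is the monomial 1, which divides any other element [v] of [F], against the antichain
     property. *)
  move: cardF; rewrite (cardsD1 u) uF => /card_gt0P[v].
  rewrite !inE => /andP[/eqP[]]; symmetry; apply: G_antichain.
  by apply/mnm_lepP => k; have := u_eq0 k; case: (val u k).
have AF : A \subset F.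
  by apply/subsetP => v; rewrite !inE => /andP[/andP[]].
(* The face condition on [A] puts the least generator [v] dividing m(A) inside [A], so [v] is at
   most [u] although [u] precedes it. *)
have /existsP[v /andP[vA /andP[_ /forall_inP min_v]]] :=
  implyP (forallP faceF A) (introT andP (conj AF A_neq0)).
have /negP[] : ~~ le v u by apply: prec_le; move: vA; rewrite inE => /andP[].
by apply: min_v; rewrite inE.
Qed.

Lemma generic_minimal_lyubeznik (K : fieldType) :
  minimal_lyubeznik_resolution K le.
Proof.
move=> i i_gt0 x; apply: in_max_ideal_mul_sum => F _.
apply/in_max_ideal_mulZ/in_max_ideal_mul_sum => u uF.
apply/in_max_ideal_scale/in_max_idealM/in_max_idealX.
have /andP[faceF /eqP cardF] := valP F.
have := face_ndvd_mdegree faceF _ uF; rewrite cardF ltnS i_gt0 => /(_ isT).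
(* A zero truncated difference of exponents means that m(F) divides m(F \ u), hence so does [u]. *)
apply: contra => /eqP m0; apply/mnm_lepP => k.
apply: leq_trans (leq_mdegree k uF) _.
by rewrite -subn_eq0 -mnmBE m0 mnm0E.
Qed.

End LyubeznikFaces.

Theorem proposition5p8 (K : fieldType) (n : nat) (I : {mpoly K[n]} -> Prop)
    (hI : monomial_ideal I) (htame : tame_ideal I) : lyubeznik_ideal I.
Proof.
have [G minG [[genericG _] prec_irr prec_trans]] := htame.
exists G => //; pose r := [rel u v : G | prec (val u) (val v)].
exists (linear_extension r); first exact: linear_extension_total_order.
apply: generic_minimal_lyubeznik => // u v uv.
  rewrite (@linear_extensionF _ r) // => [w|b a c]; first exact/prec_irr/fsvalP.
  by apply: prec_trans; apply: fsvalP.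
exact/val_inj/(minimal_generators_antichain minG _ _ uv)/fsvalP/fsvalP.
Qed.
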